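(* Let $G$ be a cluster graph that is not $\eta$-balanced, and let $k,\eta$ be non-negative integers. If there exists $F\subseteq\binom{V(G)}{2}\setminus E(G)$ with $|F|\le k$ such that $G+F$ is an $\eta$-balanced cluster graph, then $\mathrm{scomp}(G)\le k$ and $\mathrm{lcomp}(G)\le 2k+\eta$.
   Context: A cluster graph is a graph in which every connected component is a clique; a graph is $\eta$-balanced if any two of its connected components differ in number of vertices by at most $\eta$. $G+F=(V(G),E(G)\cup F)$. $\mathrm{lcomp}(G)$ and $\mathrm{scomp}(G)$ denote the number of vertices of a largest and of a smallest connected component of $G$, respectively. *)

(* Defs.v *)
From mathcomp Require Import all_boot.

Set Implicit Arguments.
Unset Strict Implicit.
Unset Printing Implicit Defensive.

Section Graphs.
Variable T : finType.

Definition pairs : {set {set T}} := [set e : {set T} | #|e| == 2].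

Record graph := Graph { edges : {set {set T}}; edgesP : edges \subset pairs }.

Implicit Types (G : graph) (F : {set {set T}}) (K : {set T}).

Definition adj G : rel T := fun x y => [set x; y] \in edges G.

Lemma add_edges_subproof G F (hF : F \subset pairs :\: edges G) :
  edges G :|: F \subset pairs.
Proof. by rewrite subUset edgesP (subset_trans hF) ?subsetDl. Qed.

(* G + F, for a set F of non-edges of G *)
Definition add_edges G F (hF : F \subset pairs :\: edges G) : graph :=
  Graph (add_edges_subproof hF).

Definition components G : {set {set T}} :=
  equivalence_partition (connect (adj G)) [set: T].

Definition clique G K : bool :=
  [forall x in K, forall y in K, (x != y) ==> adj G x y].

Definition cluster_graph G : bool := [forall C in components G, clique G C].

(* C and D range over all ordered pairs of components, so this bounds the
   absolute value of the difference of their sizes *)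
Definition balanced (eta : nat) G : bool :=
  [forall C in components G, forall D in components G, #|C| <= #|D| + eta].

Definition lcomp G : nat := \max_(C in components G) #|C|.

(* #|T| bounds the size of every component, so using it as the default value
   does not affect the minimum when T is nonempty *)
Definition scomp G : nat := \big[minn/#|T|]_(C in components G) #|C|.

End Graphs.

(* Main.v *)
Require Import Defs.
From mathcomp Require Import all_boot.

Set Implicit Arguments.
Unset Strict Implicit.
Unset Printing Implicit Defensive.

(** Let [C], [D] be components of [G] with [#|C| > #|D| + eta]. In [G + F], the
    component [D'] containing [D] is not [D] itself, since its size is within
    [eta] of that of the component containing [C]. As [D'] is a clique, every
    pair with one end in [D] and the other in [D' :\: D] is in [F]; counting
    such pairs at a fixed end gives [#|D| <= k] and [#|D' :\: D| <= k]. Every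
    component of [G] has size at most [#|D'| + eta <= 2 * k + eta]. *)

Lemma bigminn_le (I : eqType) (r : seq I) (P : pred I) (F : I -> nat) m i :
  i \in r -> P i -> \big[minn/m]_(j <- r | P j) F j <= F i.
Proof.
move=> + Pi; elim: r => // j r IHr; rewrite inE big_cons => /predU1P[<-|/IHr le_i].
  by rewrite Pi geq_minl.
by case: ifP => // _; rewrite geq_min le_i orbT.
Qed.

(** Lets pairs with a common end [a] be counted by their other ends: an element of [A] in such a
    pair is never [a], so the pair determines it. *)
Lemma set2_inj (T : finType) (a : T) (A : {set T}) :
  a \notin A -> {in A &, injective (fun x => [set a; x])}.
Proof.
move=> aA x y xA _ /setP/(_ x); rewrite !inE eqxx orbT => /esym/orP[]/eqP // xa.
by rewrite -xa xA in aA.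
Qed.

Section Components.
Context {T : finType}.
Implicit Types (G : graph T) (C : {set T}) (x y : T).

(** Indexing components by a vertex allows those of [G] and [G + F] at the same vertex to be
    compared. *)
Definition component G x : {set T} := [set y | connect (adj G) x y].

Lemma component_refl G x : x \in component G x.
Proof. by rewrite inE connect0. Qed.

Lemma component_in G x : component G x \in components G.
Proof. by apply/imsetP; exists x => //; apply/setP=> y; rewrite !inE. Qed.

Lemma componentsP G C : C \in components G -> exists x, C = component G x.
Proof.
by case/imsetP=> x _ ->; exists x; apply/setP=> y; rewrite !inE.
Qed.

Lemma lcomp_le G n :
  (forall x, #|component G x| <= n) -> lcomp G <= n.
Proof. by move=> le_n; apply/bigmax_leqP => C /componentsP[x ->]. Qed.

Lemma scomp_le G x : scomp G <= #|component G x|.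
Proof. by apply: bigminn_le (component_in G x); rewrite mem_index_enum. Qed.

Lemma balanced_component eta G :
  reflect (forall x y, #|component G x| <= #|component G y| + eta)
          (balanced eta G).
Proof.
apply: (iffP forall_inP) => [bal x y | bal C /componentsP[x ->]].
  exact: (forall_inP (bal _ (component_in G x))) (component_in G y).
by apply/forall_inP => D /componentsP[y ->].
Qed.

Lemma cluster_adj G x y z : cluster_graph G ->
  y \in component G x -> z \in component G x -> y != z -> adj G y z.
Proof.
move=> /forall_inP/(_ _ (component_in G x))/forall_inP clq yC zC.
by move/implyP: (forall_inP (clq _ yC) _ zC).
Qed.

End Components.

Section AddEdges.
Variables (T : finType) (G : graph T) (F : {set {set T}}).
Hypothesis F_nonedges : F \subset pairs T :\: edges G.
Let H := add_edges F_nonedges.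

Lemma component_add_edges x : component G x \subset component H x.
Proof.
apply/subsetP=> y; rewrite !inE; apply: connect_sub => u v uv.
by apply: connect1; rewrite /adj inE [_ \in edges G]uv.
Qed.

(** The ends are distinct vertices of one clique of [H], hence adjacent there; were the edge in [G],
    it would connect [y] to [x] already in [G]. *)
Lemma cluster_new_edge x s y : cluster_graph H ->
  s \in component G x -> y \in component H x :\: component G x ->
  [set s; y] \in F.
Proof.
move=> clH sx /setDP[yHx yGx].
have sy : s != y by apply: contraNneq yGx => <-.
have := cluster_adj clH (subsetP (component_add_edges x) _ sx) yHx sy.
rewrite /adj inE => /orP[Gsy|//]; case/negP: yGx.
by move: sx; rewrite !inE => /connect_trans; apply; apply: connect1.
Qed.

(** Here the fixed end is the new vertex [y], and the other end runs over the old component. *)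
Lemma card_component_new x y : cluster_graph H ->
  y \in component H x :\: component G x -> #|component G x| <= #|F|.
Proof.
move=> clH yD; have /setDP[_ yGx] := yD.
rewrite -(card_in_imset (set2_inj yGx)); apply/subset_leq_card/subsetP.
by move=> _ /imsetP[s sx ->]; rewrite setUC (cluster_new_edge clH sx yD).
Qed.

(** The reverse count: the fixed end is the old vertex [x], and the other end runs over the new
    vertices. *)
Lemma card_new_component x : cluster_graph H ->
  #|component H x :\: component G x| <= #|F|.
Proof.
move=> clH; have xD : x \notin component H x :\: component G x.
  by rewrite inE component_refl.
rewrite -(card_in_imset (set2_inj xD)); apply/subset_leq_card/subsetP.
by move=> _ /imsetP[y yD ->]; apply: cluster_new_edge yD; rewrite ?component_refl.
Qed.

End AddEdges.

Theorem mainTheorem19 (T : finType) (G : graph T) (k eta : nat)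
  (hG : cluster_graph G) (hGb : ~~ balanced eta G)
  (hF : exists (F : {set {set T}}) (F_nonedges : F \subset pairs T :\: edges G),
      [/\ #|F| <= k,
          cluster_graph (add_edges F_nonedges) &
          balanced eta (add_edges F_nonedges)]) :
  scomp G <= k /\ lcomp G <= 2 * k + eta.
Proof.
case: hF => F [nF [Fk clH /balanced_component balH]].
have subC := component_add_edges nF.
have leC x d : #|component G x| <= #|component (add_edges nF) d| + eta.
  exact: leq_trans (subset_leq_card (subC x)) (balH x d).
have [c [d ltdc]] : exists c d, #|component G d| + eta < #|component G c|.
  case/forall_inPn: hGb => C /componentsP[c ->].
  by case/forall_inPn=> D /componentsP[d ->]; rewrite -ltnNge; exists c, d.
have [y yD] : exists y, y \in component (add_edges nF) d :\: component G d.
  (* If the component of [d] gained no vertex, [leC c d] would bound that of [c] by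
     [#|component G d| + eta], against [ltdc]. *)
  apply/set0Pn; rewrite setD_eq0; apply: contraL ltdc => /subset_leq_card le_d.
  by rewrite -leqNgt (leq_trans (leC c d)) // leq_add2r.
have dk := leq_trans (card_component_new clH yD) Fk.
split; first exact: leq_trans (scomp_le G d) dk.
apply: lcomp_le => x; apply: leq_trans (leC x d) _.
(* One [k] pays for the old vertices of the enlarged component, the other for the new ones. *)
rewrite leq_add2r -(cardsID (component G d)) (setIidPr (subC d)) mul2n -addnn.
exact: leq_add dk (leq_trans (card_new_component d clH) Fk).
Qed.
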